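(* Let $n\in\{1,2,\dots\}$ and let $R^{\text{random}}$ be the random subset of $\{0,\dots,n-1\}$ defined in the context. Whenever $m\in\{1,\dots,n\}$ and $0\le x_1<\dots<x_m<n$ are integers, $$\mathbb P\big(R^{\text{random}}=\{x_1,\dots,x_m\}\big)=\frac1n\,p(2x_1,0)\cdot\prod_{k=1}^{m-1}\Big(p(2x_{k+1}-2x_k-2,\,0)-p(2x_{k+1}-2x_k,\,0)\Big).$$
   Context: Let $I=\{(x,y): x=0,1,\dots,n-1,\ y=-x,-x+2,\dots,x-2,x\}$. Let $\tau(x,y)$, $(x,y)\in I$, be independent random signs, each equal to $-1$ or $+1$ with probability $1/2$. Define $W(0)=0$ and $W(x+1)=W(x)+\tau(x,W(x))$ for $x=0,\dots,n-1$. For $S\subset I$ put $\tau(S)=\prod_{(x,y)\in S}\tau(x,y)$ (with $\tau(\emptyset)=1$). The Fourier-Walsh coefficients of $\xi=n^{-1/2}W(n)$ are $\hat\xi(S)=\mathbb E(\tau(S)\,\xi)$, so that $\xi=\sum_{S\subset I}\hat\xi(S)\tau(S)$ and $\sum_{S\subset I}|\hat\xi(S)|^2=\mathbb E\,\xi^2=1$. The spectral measure of $\xi$ is the probability measure $\mu_\xi$ on $2^I$ given by $\mu_\xi(A)=\sum_{S\in A}|\hat\xi(S)|^2$ for $A\subset 2^I$. Let $S^{\text{random}}$ be a random subset of $I$ distributed according to $\mu_\xi$, and let $R^{\text{random}}$ be its projection to the first axis, $R^{\text{random}}=\{x:(x,y)\in S^{\text{random}}\text{ for some }y\}$. For integers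 $x\ge0$ and $y$ with $|y|\le x$ and $x-y$ even, $p(x,y)=2^{-x}\dfrac{x!}{\left(\frac{x-y}2\right)!\left(\frac{x+y}2\right)!}$. An empty product equals $1$. *)

(* Defs.v *)
From HB Require Import structures.
From mathcomp Require Import all_boot all_order all_algebra finmap.
From mathcomp Require Import all_classical all_reals all_analysis.

Set Implicit Arguments.
Unset Strict Implicit.
Unset Printing Implicit Defensive.

Import Order.TTheory GRing.Theory Num.Theory.

Local Open Scope classical_set_scope.
Local Open Scope fset_scope.
Local Open Scope ring_scope.

(* Discrete sigma-algebras on the countable types of signs and of finite sets
   of lattice points, so that the library's random variables and distributions
   apply to them. *)
HB.instance Definition _ := isPointed.Build int 0.

HB.instance Definition _ := @isMeasurable.Build default_measure_display
  int (@discrete_measurable int) (@discrete_measurable0 int)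
  (@discrete_measurableC int) (@discrete_measurableU int).

HB.instance Definition _ := @isMeasurable.Build default_measure_display
  {fset nat * int} (@discrete_measurable {fset nat * int})
  (@discrete_measurable0 {fset nat * int})
  (@discrete_measurableC {fset nat * int})
  (@discrete_measurableU {fset nat * int}).

Definition lattice (n : nat) : {fset nat * int} :=
  [fset p in [seq (x, - x%:Z + (2 * k)%:Z) | x <- iota 0 n, k <- iota 0 x.+1]].

Definition independent_family {R : realType} {d : measure_display}
    {T : measurableType d} (P : probability T R)
    {d' : measure_display} {T' : measurableType d'} {I : choiceType}
    (D : {fset I}) (X : I -> {RV P >-> T'}) : Prop :=
  forall (J : {fset I}) (B : I -> set T'),
    J `<=` D -> (forall i, i \in J -> measurable (B i)) ->
    P [set w | forall i, i \in J -> B i (X i w)]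
      = (\prod_(i <- J) P (X i @^-1` B i))%E.

(* The values of [tau] outside [lattice n] are irrelevant. *)
Definition random_signs {R : realType} {d : measure_display}
    {T : measurableType d} (P : probability T R) (n : nat)
    (tau : nat * int -> {RV P >-> int}) : Prop :=
  [/\ forall p w, p \in lattice n -> tau p w = -1 \/ tau p w = 1,
      forall p, p \in lattice n -> P [set w | tau p w = -1] = (2^-1)%:E,
      forall p, p \in lattice n -> P [set w | tau p w = 1] = (2^-1)%:E
    & independent_family (lattice n) tau].

Section FourierWalsh.
Context {R : realType} {d : measure_display} {T : measurableType d}.
Context (P : probability T R) (tau : nat * int -> {RV P >-> int}) (n : nat).

Fixpoint walk (x : nat) (w : T) : int :=
  if x is x'.+1 then walk x' w + tau (x', walk x' w) w else 0.

Definition walsh (S : {fset nat * int}) (w : T) : int :=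
  \prod_(p <- S) tau p w.

Definition endpoint (w : T) : R := (Num.sqrt n%:R)^-1 * (walk n w)%:~R.

Definition fourier_walsh (f : T -> R) (S : {fset nat * int}) : R :=
  fine 'E_P[fun w => (walsh S w)%:~R * f w].

Definition spectral_measure (f : T -> R) (A : set {fset nat * int}) : R :=
  \sum_(S <- fpowerset (lattice n) | S \in A) `|fourier_walsh f S| ^+ 2.

End FourierWalsh.

Definition first_projection (S : {fset nat * int}) : {fset nat} :=
  [fset p.1 | p in S].

(* Meant for [|y| <= x] with [x - y] even, so that both halves are exact and
   nonnegative. *)
Definition walk_prob (R : realType) (x : nat) (y : int) : R :=
  2 ^- x * (x`!%:R / ((`|((x%:Z - y) %/ 2)%Z|%N)`!%:R
                      * (`|((x%:Z + y) %/ 2)%Z|%N)`!%:R)).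

(* Main.v *)
Require Import Defs.
From mathcomp Require Import all_boot all_order all_algebra finmap.
From mathcomp Require Import all_classical all_reals all_analysis.
From mathcomp Require Import zify ring lra.

Import Order.TTheory GRing.Theory Num.Theory.
Local Open Scope classical_set_scope.
Local Open Scope fset_scope.
Local Open Scope ring_scope.

(** Write [W] for the walk. Its endpoint is the sum over [t] of the sign found
at [(t, W t)], so it is a martingale transform: each increment is a sign at
level [t] times a function of the signs at earlier levels. The indicator that
[W x = y] has the same form: its conditional expectation given the first [t]
levels is the transition kernel from [W t] to [y] in [x - t] steps, and when
the walk makes the step [t] this expectation changes by the sign used times
half the difference of the kernels seen from the two neighbours
([visits_martingale]).

For a martingale transform, flipping one sign kills almost every Fourier-Walsh
coefficient. The coefficient at [S] vanishes unless [S] is empty or has a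
single point [p] at its highest level, and then it is the factor attached to
[p] times the coefficient, at [S] without [p], of the indicator that the walk
passes through [p] ([coefficient_neq0_top], [coefficient_top]). Hence the total
squared coefficient over the sets of a given projection satisfies a recursion
that removes the last level ([energy_transform]). Because the factor depends
only on the displacement between two points, the recursion multiplies the
energy by the sum of the squared kernel differences ([level_energyU1]).

This sum is a difference of two return probabilities
([sum_kernel_jump_sq]): the squares of the kernel at time [N] sum to the
probability of return at time [2 * N], and the parallelogram identity reduces
the squared differences to such squares. The first level contributes
[walk_prob R (2 * x 1) 0] for the same reason, and the factor [n^-1] is the
squared normalisation of the endpoint. Independence is used only to see that
the set of sites carrying the sign -1 is uniform over all subsets of the
lattice ([minus_signs_law]), which turns expectations into finite averages. *)

(** * Transition kernel of the simple random walk *)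

Fixpoint step_kernel (R : realType) (N : nat) (d : int) : R :=
  if N is N'.+1 then (step_kernel R N' (d - 1) + step_kernel R N' (d + 1)) / 2
  else (d == 0)%:R.

Lemma step_kernel_out (R : realType) (N : nat) (d : int) :
  N%:Z < `|d| -> step_kernel R N d = 0.
Proof.
elim: N d => [|N IH] d hd /=; first by case: eqP => // ?; lia.
by rewrite !IH ?addr0 ?mul0r //; lia.
Qed.

Lemma step_kernel_binomial (R : realType) (N k : nat) :
  step_kernel R N ((2 * k)%:Z - N%:Z) = 'C(N, k)%:R / 2 ^+ N.
Proof.
elim: N k => [|N IH] k /=.
  by rewrite subr0 divr1; case: k.
have -> : (2 * k)%:Z - N.+1%:Z + 1 = (2 * k)%:Z - N%:Z by lia.
rewrite IH exprS invfM; case: k => [|k].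
  have -> : (2 * 0)%:Z - N.+1%:Z - 1 = - N.+2%:Z by lia.
  have -> : step_kernel R N (- N.+2%:Z) = 0.
    by rewrite step_kernel_out //; lia.
  by rewrite !bin0 add0r; field; rewrite expf_neq0.
have -> : (2 * k.+1)%:Z - N.+1%:Z - 1 = (2 * k)%:Z - N%:Z by lia.
by rewrite IH binS natrD; field; rewrite expf_neq0.
Qed.

Lemma central_walk_prob (R : realType) (N : nat) :
  walk_prob R (2 * N) 0 = 'C(2 * N, N)%:R / 2 ^+ (2 * N).
Proof.
rewrite /walk_prob subr0.
have -> : ((2 * N)%:Z %/ 2)%Z = N%:Z by lia.
rewrite absz_nat mulrC; congr (_ / _).
have <- : ('C(2 * N, N) * (N`! * (2 * N - N)`!) = (2 * N)`!)%N.
  by apply: bin_fact; lia.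
have -> : (2 * N - N = N)%N by lia.
by rewrite !natrM mulfK // -natrM pnatr_eq0 -lt0n muln_gt0 fact_gt0.
Qed.

(** On a window that contains the support, the squares of the kernel add up to
the return probability: two independent walks meet at time [N] exactly when
their difference, a walk of [2 * N] steps, is back at the origin. *)
Lemma sum_step_kernel_sq (R : realType) (N j K : nat) : (j + N < K)%N ->
  \sum_(0 <= k < K) step_kernel R N ((2 * k)%:Z - N%:Z - (2 * j)%:Z) ^+ 2
  = walk_prob R (2 * N) 0.
Proof.
move=> hK; rewrite central_walk_prob.
rewrite (big_cat_nat (n := j)) //=; last by lia.
rewrite [X in X + _]big_nat big1 ?add0r; last first.
  by move=> k hk; rewrite step_kernel_out ?expr0n //; lia.
rewrite (big_cat_nat (n := (j + N).+1)) //=; last by lia.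
rewrite [X in _ + X]big_nat [X in _ + X]big1 ?addr0; last first.
  by move=> k hk; rewrite step_kernel_out ?expr0n //; lia.
rewrite -{1}(add0n j) big_addn.
have -> : ((j + N).+1 - j = N.+1)%N by lia.
rewrite big_mkord.
transitivity (\sum_(i < N.+1) ('C(N, i) * 'C(N, N - i))%:R / 2 ^+ (2 * N) : R).
  apply: eq_bigr => i _.
  have -> : (2 * (i + j))%:Z - N%:Z - (2 * j)%:Z = (2 * i)%:Z - N%:Z by lia.
  rewrite step_kernel_binomial bin_sub -1?ltnS // natrM mul2n -addnn exprD.
  by field; rewrite expf_neq0.
rewrite -mulr_suml -natr_sum binomial.Vandermonde.
by rewrite addnn mul2n.
Qed.

Definition kernel_jump (R : realType) (N : nat) (d : int) : R :=
  (step_kernel R N (d - 1) - step_kernel R N (d + 1)) / 2.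

(** The parallelogram identity turns the squared jump into squares of kernels
at times [N] and [N.+1], and both of these sum to return probabilities. *)
Lemma sum_kernel_jump_sq (R : realType) (N j K : nat) : (j + N.+1 < K)%N ->
  \sum_(0 <= k < K) kernel_jump R N ((2 * k)%:Z - N.+1%:Z - (2 * j)%:Z) ^+ 2
  = walk_prob R (2 * N) 0 - walk_prob R (2 * N.+1) 0.
Proof.
move=> hK.
rewrite -(@sum_step_kernel_sq R N.+1 j K hK).
have -> : walk_prob R (2 * N) 0 =
   (walk_prob R (2 * N) 0 + walk_prob R (2 * N) 0) / 2 by field.
rewrite -{1}(@sum_step_kernel_sq R N j.+1 K); last by lia.
rewrite -(@sum_step_kernel_sq R N j K); last by lia.
rewrite -big_split /= mulr_suml -sumrB; apply: eq_bigr => k _.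
rewrite /kernel_jump.
have -> : (2 * k)%:Z - N.+1%:Z - (2 * j)%:Z - 1
        = (2 * k)%:Z - N%:Z - (2 * j.+1)%:Z by lia.
have -> : (2 * k)%:Z - N.+1%:Z - (2 * j)%:Z + 1
        = (2 * k)%:Z - N%:Z - (2 * j)%:Z by lia.
by field.
Qed.

(** * Fourier-Walsh analysis on finite sets of minus signs *)

Section SignSets.
Context {R : realType} {K : choiceType}.
Implicit Types (L A S : {fset K}) (p q : K).

(** A configuration of signs is encoded by the set [A] of the points that carry
-1, so that configurations on [L] are the members of [fpowerset L]. *)
Definition sign_at A p : int := if p \in A then -1 else 1.

Definition flip p A : {fset K} := if p \in A then A `\ p else p |` A.

Lemma sign_at_flip p A q :
  sign_at (flip p A) q = if q == p then - sign_at A q else sign_at A q.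
Proof.
rewrite /sign_at /flip; case: (boolP (p \in A)) => pA; rewrite !inE.
  by case: eqVneq => [->|] //=; rewrite pA opprK.
by case: eqVneq => [->|] //=; rewrite (negbTE pA).
Qed.

Lemma flipK p : involutive (flip p).
Proof.
move=> A; rewrite /flip; case: (boolP (p \in A)) => pA; rewrite !inE eqxx /=.
  by rewrite fsetD1K.
by rewrite fsetU1K.
Qed.

Lemma flip_sub L p A : p \in L -> (flip p A `<=` L) = (A `<=` L).
Proof.
move=> pL; suff sub B : B `<=` L -> flip p B `<=` L.
  by apply/idP/idP => [/sub|/sub //]; rewrite flipK.
move=> BL; rewrite /flip; case: ifP => _.
  exact: fsubset_trans (fsubD1set _ _) BL.
by rewrite fsubUset fsub1set pL.
Qed.

Definition average L (f : {fset K} -> R) : R :=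
  2 ^- #|` L| * \sum_(A <- fpowerset L) f A.

Definition character S A : R := (\prod_(p <- S) sign_at A p)%:~R.

Definition coefficient L (f : {fset K} -> R) S : R :=
  average L (fun A => character S A * f A).

Lemma average_cst L (c : R) : average L (fun=> c) = c.
Proof.
rewrite /average big_const_seq count_predT card_fpowerset.
rewrite iter_addr_0 -[c *+ _]mulr_natr natrX mulrCA.
by rewrite mulVf ?mulr1 // expf_neq0.
Qed.

Lemma average_flip L p f : p \in L ->
  average L (fun A => f (flip p A)) = average L f.
Proof.
move=> pL; congr (_ * _).
rewrite -(big_map (flip p) xpredT f); apply: perm_big; apply: uniq_perm.
- by rewrite map_inj_uniq ?fset_uniq //; exact: inv_inj (flipK p).
- exact: fset_uniq.
move=> A; apply/mapP/idP => [[B hB ->]|hA].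
  by move: hB; rewrite !fpowersetE flip_sub.
by exists (flip p A); rewrite ?flipK // fpowersetE flip_sub // -fpowersetE.
Qed.

(** This is the form in which independence and symmetry of the signs enter every
computation of a coefficient. *)
Lemma average_odd L p f : p \in L ->
  (forall A, f (flip p A) = - f A) -> average L f = 0.
Proof.
move=> pL odd_f; have := average_flip L p f pL.
have -> : average L (fun A => f (flip p A)) = - average L f.
  rewrite /average -mulrN -sumrN; congr (_ * _).
  by apply: eq_bigr => A _; rewrite odd_f.
lra.
Qed.

Lemma average_sum L (I : Type) (r : seq I) (F : I -> {fset K} -> R) :
  average L (fun A => \sum_(i <- r) F i A) = \sum_(i <- r) average L (F i).
Proof. by rewrite /average exchange_big mulr_sumr. Qed.

Lemma averageD L f g :
  average L (fun A => f A + g A) = average L f + average L g.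
Proof. by rewrite /average big_split mulrDr. Qed.

Lemma averageZ L (c : R) f : average L (fun A => c * f A) = c * average L f.
Proof. by rewrite /average -mulr_sumr mulrCA. Qed.

Lemma eq_average L f g : f =1 g -> average L f = average L g.
Proof. by move=> fg; congr (_ * _); apply: eq_bigr. Qed.

Lemma character_cons S p A : p \in S ->
  character S A = (sign_at A p)%:~R * character (S `\ p) A.
Proof.
by move=> pS; rewrite /character (big_fsetD1 p) //= intrM.
Qed.

Lemma character_flip S p A :
  character S (flip p A) = (-1) ^+ (p \in S) * character S A.
Proof.
have out (U : {fset K}) : p \notin U -> character U (flip p A) = character U A.
  move=> pU; congr (_%:~R); rewrite !big_seq; apply: eq_bigr => q qU.
  by rewrite sign_at_flip; case: eqP qU pU => // -> ->.
case: (boolP (p \in S)) => pS; last by rewrite out // mul1r.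
rewrite !(character_cons S p _ pS) out ?inE ?eqxx // sign_at_flip eqxx.
by rewrite rmorphN expr1 !mulN1r mulNr.
Qed.

Lemma sign_at_sq A p : (sign_at A p)%:~R * (sign_at A p)%:~R = 1 :> R.
Proof. by rewrite /sign_at; case: ifP => _; rewrite -intrM. Qed.

End SignSets.

(** * The walk in a fixed sign environment *)

Section Walk.
Context {R : realType}.
Implicit Types (A S : {fset nat * int}) (X : {fset nat}) (p q : nat * int).

(** The [k]-th point, from below, among those that the walk can reach at
time [t]. *)
Definition site (t k : nat) : int := - t%:Z + (2 * k)%:Z.

Lemma site_inj t : injective (site t).
Proof. by rewrite /site => j k; lia. Qed.

Lemma latticeP n p : reflect
  (exists2 k, (k < p.1.+1)%N & p.2 = site p.1 k /\ (p.1 < n)%N)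
  (p \in lattice n).
Proof.
rewrite /lattice !inE; apply: (iffP allpairsPdep) => [|[k kp [pE pn]]].
  move=> [t [k [ht hk ->]]] /=; move: ht hk; rewrite !mem_iota => ht hk.
  by exists k => //; split=> //; lia.
exists p.1, k; rewrite !mem_iota; split; [lia|lia|].
by rewrite [LHS]surjective_pairing pE.
Qed.

Fixpoint position A (t : nat) : int :=
  if t is t'.+1 then position A t' + sign_at A (t', position A t') else 0.

Lemma position_site A t : exists2 k, (k < t.+1)%N & position A t = site t k.
Proof.
elim: t => [|t [k kt pE]]; first by exists 0%N.
rewrite /= pE /sign_at; case: ifP => _.
  by exists k; rewrite /site; lia.
by exists k.+1; rewrite /site; lia.
Qed.

Lemma position_flip A p t : (t <= p.1)%N ->
  position (flip p A) t = position A t.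
Proof.
elim: t => //= t IH tp; rewrite !IH; try lia.
by rewrite sign_at_flip; case: eqP => // pE; move: tp; rewrite -pE /= ltnn.
Qed.

Definition visits p A : R := (position A p.1 == p.2)%:R.

Lemma sum_visits A t (F : int -> R) :
  \sum_(0 <= k < t.+1) F (site t k) * visits (t, site t k) A
  = F (position A t).
Proof.
have [k kt pE] := position_site A t.
rewrite (bigD1_seq k) ?iota_uniq ?mem_index_iota //= big1 ?addr0.
  by rewrite /visits /= pE eqxx mulr1.
move=> j jk; rewrite /visits /= pE; case: eqP => [/site_inj|]; last first.
  by rewrite mulr0.
by move=> kj; rewrite kj eqxx in jk.
Qed.

(** The sign at [(s, position A s)] is independent of [position A s], so the
summands are martingale increments for the filtration by levels. *)
Definition martingale_transform
    (c : R) (t : nat) (phi : nat * int -> R) A : R :=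
  c + \sum_(0 <= s < t) (sign_at A (s, position A s))%:~R
                        * phi (s, position A s).

Definition step_through p A : R := (sign_at A p)%:~R * visits p A.

Lemma transform_sites c t phi A :
  martingale_transform c t phi A
  = c + \sum_(0 <= s < t) \sum_(0 <= k < s.+1)
          phi (s, site s k) * step_through (s, site s k) A.
Proof.
congr (_ + _); apply: eq_bigr => s _.
rewrite -(sum_visits A s (fun y => (sign_at A (s, y))%:~R * phi (s, y))).
by apply: eq_bigr => k _; rewrite /step_through; ring.
Qed.

(** The conditional expectation of [visits (x, y) A] given the first [t] levels
is [step_kernel R (x - t) (y - position A t)], and the increments of this
martingale telescope from the constant [step_kernel R x y] to the indicator. *)
Lemma visits_martingale x y A :
  visits (x, y) A
  = martingale_transform (step_kernel R x y) x
      (fun p => kernel_jump R (x - p.1.+1) (y - p.2)) A.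
Proof.
rewrite /martingale_transform /=.
pose M t := step_kernel R (x - t) (y - position A t).
transitivity (step_kernel R x y + \sum_(0 <= t < x) (M t.+1 - M t)).
  rewrite telescope_sumr // /M subnn /= subn0 subr0 addrC subrK.
  by rewrite /visits /= subr_eq0 eq_sym.
congr (_ + _); apply: eq_big_nat => t /= tx; rewrite /M /kernel_jump /=.
have -> : (x - t = (x - t.+1).+1)%N by lia.
rewrite opprD addrA /= /sign_at; case: ifP => _.
  by rewrite opprK; field.
by field.
Qed.

Lemma endpoint_transform t A :
  (position A t)%:~R = martingale_transform 0 t (fun=> 1) A.
Proof.
rewrite /martingale_transform add0r.
elim: t => [|t IH]; first by rewrite big_geq.
by rewrite big_nat_recr //= -IH mulr1 rmorphD.
Qed.

Definition below (t : nat) S := forall q, q \in S -> (q.1 < t)%N.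

Lemma visits_flip p q A : (p.1 <= q.1)%N -> visits p (flip q A) = visits p A.
Proof. by move=> pq; rewrite /visits position_flip. Qed.

Lemma step_through_flip p q A : (p.1 <= q.1)%N ->
  step_through p (flip q A) = (-1) ^+ (q == p) * step_through p A.
Proof.
move=> pq; rewrite /step_through visits_flip // sign_at_flip eq_sym.
by case: eqP => _; rewrite /= ?expr1 ?mul1r // rmorphN mulN1r mulNr.
Qed.

Section Coefficients.
Context (n : nat).
Local Notation L := (lattice n).

(** Flipping the sign at [p] itself reverses [step_through p] but not the
character. *)
Lemma coefficient_step_notin p S : p \in L -> p \notin S ->
  coefficient L (step_through p) S = 0.
Proof.
move=> pL pS; apply: (average_odd L p) => // A.
rewrite character_flip (negbTE pS) step_through_flip // eqxx.
by rewrite mul1r mulN1r mulrN.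
Qed.

(** Flipping [q] reverses the character, while the walk cannot notice it before
its step at the level of [p]. *)
Lemma coefficient_step_later p q S : q \in L -> q \in S -> q != p ->
  (p.1 <= q.1)%N -> coefficient L (step_through p) S = 0.
Proof.
move=> qL qS qp pq; apply: (average_odd L q) => // A.
rewrite character_flip qS step_through_flip // (negbTE qp).
by rewrite mul1r mulN1r mulNr.
Qed.

Lemma coefficient_step_in p S : p \in S ->
  coefficient L (step_through p) S = coefficient L (visits p) (S `\ p).
Proof.
move=> pS; apply: eq_average => A; rewrite (character_cons S p A pS).
by rewrite /step_through mulrACA sign_at_sq mul1r.
Qed.

Lemma coefficient_transform c t phi S :
  coefficient L (martingale_transform c t phi) S
  = coefficient L (fun=> c) S + \sum_(0 <= s < t) \sum_(0 <= k < s.+1)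
      phi (s, site s k) * coefficient L (step_through (s, site s k)) S.
Proof.
rewrite /coefficient.
under eq_average do rewrite transform_sites mulrDr mulr_sumr.
rewrite averageD average_sum; congr (_ + _); apply: eq_bigr => s _.
under eq_average do rewrite mulr_sumr.
rewrite average_sum; apply: eq_bigr => k _; rewrite -averageZ.
by apply: eq_average => A; ring.
Qed.

Lemma coefficient_cst (c : R) S : S `<=` L -> S != fset0 ->
  coefficient L (fun=> c) S = 0.
Proof.
move=> /fsubsetP SL /fset0Pn[p pS]; apply: (average_odd L p _ (SL p pS)) => A.
by rewrite character_flip pS expr1 mulN1r mulNr.
Qed.

Lemma site_lattice s k : (s < n)%N -> (k < s.+1)%N -> (s, site s k) \in L.
Proof. by move=> sn ks; apply/latticeP; exists k. Qed.

(** Among all the steps, only the one through [p] correlates with the character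
of [p |` S]: a step through [q] outside this set is odd in the sign at [q], and
a step through [q] in [S] comes before the level of [p], so it does not
depend on the sign at [p]. *)
Lemma coefficient_top c t phi p S : p \in L -> S `<=` L -> below p.1 S ->
  (p.1 < t)%N -> (t <= n)%N ->
  coefficient L (martingale_transform c t phi) (p |` S)
  = phi p * coefficient L (visits p) S.
Proof.
move=> pL SL Sp pt tn; have [k kp [pE pn]] := latticeP n p pL.
have pS : p \notin S by apply/negP => /Sp; rewrite ltnn.
have pE' : (p.1, site p.1 k) = p by rewrite -pE -surjective_pairing.
have other q : q != p -> coefficient L (step_through q) (p |` S) = 0 :> R
    \/ (q \notin L).
  move=> qp; case: (boolP (q \in L)) => qL; [left|by right].
  have [qS|qS] := boolP (q \in S).
    apply: (coefficient_step_later q p) => //; rewrite ?fset1U1 1?eq_sym //.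
    exact: ltnW (Sp q qS).
  by apply: coefficient_step_notin => //; rewrite !inE negb_or qp.
rewrite coefficient_transform coefficient_cst ?add0r; first last.
- by apply/fset0Pn; exists p; rewrite fset1U1.
- by rewrite fsubUset fsub1set pL.
rewrite (bigD1_seq p.1) ?iota_uniq ?mem_index_iota //=.
rewrite (bigD1_seq k) ?iota_uniq ?mem_index_iota //= pE'.
rewrite coefficient_step_in ?fset1U1 // fsetU1K //.
rewrite big_seq_cond big1 => [|j /andP[]]; last first.
  rewrite mem_index_iota => /andP[_ jp] jk.
  case: (other (p.1, site p.1 j)) => [|->|]; rewrite ?mulr0 //.
    by rewrite -[X in _ != X]pE'; apply: contra jk => /eqP [/site_inj ->].
  by rewrite site_lattice.
rewrite big_seq_cond big1 ?addr0 // => s /andP[]; rewrite mem_index_iota.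
move=> /andP[_ st] sp; rewrite big_seq big1 // => j.
rewrite mem_index_iota => /andP[_ js].
case: (other (s, site s j)) => [|->|]; rewrite ?mulr0 //.
  by rewrite -pE'; apply: contra sp => /eqP [->].
by rewrite site_lattice //; exact: leq_trans tn.
Qed.

(** If every point of [S] has a rival at its own level or higher, then each step
through a point of [S] is killed by the sign at that rival. *)
Lemma coefficient_neq0_top c t phi S : S `<=` L -> S != fset0 -> (t <= n)%N ->
  coefficient L (martingale_transform c t phi) S != 0 ->
  exists2 p, p \in S & below p.1 (S `\ p).
Proof.
move=> SL S0 tn nz; apply: contrapT => no_top; case/eqP: nz.
rewrite coefficient_transform coefficient_cst // add0r.
rewrite big_seq big1 // => s; rewrite mem_index_iota => /andP[_ st].
rewrite big_seq big1 // => k; rewrite mem_index_iota => /andP[_ ks].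
set p := (s, site s k).
have pL : p \in L by apply: site_lattice => //; exact: leq_trans tn.
have [pS|pS] := boolP (p \in S); last by rewrite coefficient_step_notin ?mulr0.
case: (pselect (exists2 q, q \in S `\ p & (p.1 <= q.1)%N)) => [[q]|none].
  rewrite !inE => /andP[qp qS] pq.
  by rewrite (coefficient_step_later p q) ?mulr0 //; exact: (fsubsetP SL).
case: no_top; exists p => // q qS; rewrite ltnNge; apply/negP => pq.
by apply: none; exists q.
Qed.

Lemma below_projection S s X : first_projection S = X ->
  (forall z, z \in X -> (z < s)%N) -> below s S.
Proof. by move=> <- Xs q qS; apply: Xs; apply: in_imfset. Qed.

Lemma projection_site S s X k : (forall z, z \in X -> (z < s)%N) ->
  first_projection S = X ->
  (s, site s k) \notin S /\
  first_projection ((s, site s k) |` S) = s |` X.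
Proof.
move=> Xs SX; have Ss := below_projection S s X SX Xs.
split; first by apply/negP => /Ss /=; rewrite ltnn.
apply/fsetP => z; rewrite !inE -SX; apply/imfsetP/orP => /=.
  move=> [p]; rewrite !inE => /orP[/eqP -> ->|pS ->]; first by left.
  by right; apply: in_imfset.
move=> [/eqP ->|/imfsetP /= [p pS ->]].
  by exists (s, site s k) => //; rewrite fset1U1.
by exists p => //; rewrite !inE pS orbT.
Qed.

(** A set with a nonzero coefficient and projection [s |` X] meets level [s] in
one point only, so it is that point together with a set of projection [X]. *)
Lemma projection_top S s X : S `<=` L -> (forall z, z \in X -> (z < s)%N) ->
  first_projection S = s |` X ->
  (exists2 p, p \in S & below p.1 (S `\ p)) ->
  exists2 k, (k < s.+1)%N &
    (s, site s k) \in S /\ first_projection (S `\ (s, site s k)) = X.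
Proof.
move=> SL Xs SX [p pS ptop].
have leS q : q \in S -> (q.1 <= s)%N.
  move=> qS; have : q.1 \in s |` X by rewrite -SX; apply: in_imfset.
  by rewrite !inE => /orP[/eqP -> //|/Xs /ltnW].
have ps : p.1 = s.
  apply/eqP; rewrite eqn_leq leS //= leqNgt; apply/negP => lt_ps.
  have /imfsetP[q /= qS sq] : s \in first_projection S by rewrite SX fset1U1.
  have qp : q != p by apply/eqP => qp; rewrite sq qp ltnn in lt_ps.
  have : q \in S `\ p by rewrite !inE qp.
  by move=> /ptop; rewrite -sq ltnNge ltnW.
have [k kp [pE _]] := latticeP n p (fsubsetP SL p pS).
have pE' : (s, site s k) = p by rewrite -{1}ps -{1}ps -pE -surjective_pairing.
exists k; rewrite -?ps // ps pE'; split=> //.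
apply/fsetP => z; apply/imfsetP/idP => [/= [q]|zX] /=.
  rewrite !inE => /andP[qp qS] ->.
  have : q.1 \in s |` X by rewrite -SX; apply: in_imfset.
  rewrite !inE => /orP[/eqP qs|//].
  have : q \in S `\ p by rewrite !inE qp.
  by move=> /ptop; rewrite qs ps ltnn.
have /imfsetP[q /= qS zq] : z \in first_projection S by rewrite SX fset1Ur.
exists q => //; rewrite !inE qS andbT; apply/eqP => qp.
by move: (Xs z zX); rewrite zq qp ps ltnn.
Qed.

Definition site_energy s X k : R :=
  \sum_(S <- fpowerset L | first_projection S == X)
     coefficient L (visits (s, site s k)) S ^+ 2.

Definition level_energy s X : R := \sum_(0 <= k < s.+1) site_energy s X k.

(** The sets that matter are split, uniquely, into their point at level [s] and
a set of projection [X]; [coefficient_top] then factors each coefficient. *)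
Lemma energy_transform c t phi s X : (s < t)%N -> (t <= n)%N ->
  (forall z, z \in X -> (z < s)%N) ->
  \sum_(S <- fpowerset L | first_projection S == s |` X)
     coefficient L (martingale_transform c t phi) S ^+ 2
  = \sum_(0 <= k < s.+1) phi (s, site s k) ^+ 2 * site_energy s X k.
Proof.
move=> st tn Xs.
pose F S := coefficient L (martingale_transform c t phi) S ^+ 2.
have sn : (s < n)%N by exact: leq_trans tn.
pose add k S := (s, site s k) |` S.
pose lower := [seq S <- fpowerset L | first_projection S == X].
pose splits S k := ((s, site s k) \in S) &&
                   (first_projection (S `\ (s, site s k)) == X).
pose good S := has (splits S) (index_iota 0 s.+1).
pose upper := [seq S <- fpowerset L | (first_projection S == s |` X) && good S].
(* Sets with several points at level [s] have coefficient zero. *)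
transitivity (\sum_(S <- upper) F S).
  rewrite big_filter; rewrite [LHS]big_seq_cond [RHS]big_seq_cond.
  rewrite [LHS](bigID (fun S => F S == 0)) /= big1 ?add0r; last first.
    by move=> S /andP[_ /eqP].
  rewrite [RHS](bigID (fun S => F S == 0)) /=.
  rewrite [X in _ = X + _]big1 ?add0r; last first.
    by move=> S /andP[_ /eqP].
  apply: eq_bigl => S; rewrite fpowersetE -!andbA; apply: andb_id2l => SL.
  case: eqP => //= SX; case: eqP; rewrite ?andbF // => FS; rewrite andbT.
  apply/esym/hasP.
  have S0 : S != fset0.
    apply/eqP => S0; move: SX => /fsetP /(_ s); rewrite S0 fset1U1.
    by move=> /imfsetP [].
  have [k ks [kS kX]] : exists2 k, (k < s.+1)%N &
      (s, site s k) \in S /\ first_projection (S `\ (s, site s k)) = X.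
    apply: projection_top => //; apply: (coefficient_neq0_top c t phi) => //.
    by apply/eqP => cS; apply: FS; rewrite /F cS expr0n.
  by exists k; rewrite ?mem_index_iota // /splits kS kX eqxx.
(* The remaining sets are the images of the pairs (site, lower set) under an
   injective map. *)
transitivity
  (\sum_(S <- [seq add k U | k <- index_iota 0 s.+1, U <- lower]) F S).
  apply: perm_big; apply: uniq_perm.
  - by rewrite filter_uniq ?fset_uniq.
  - apply: allpairs_uniq; rewrite ?iota_uniq ?filter_uniq ?fset_uniq //.
    move=> [k S] [k' S'] /allpairsPdep[j [U [_ + [-> ->]]]].
    rewrite mem_filter => /andP[/eqP UX _].
    move=> /allpairsPdep[j' [U' [_ + [-> ->]]]].
    rewrite mem_filter => /andP[/eqP UX' _].
    have [jU _] := projection_site U s X j Xs UX.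
    have [jU' _] := projection_site U' s X j' Xs UX'.
    rewrite /add => /= UU'.
    have jj' : j = j'.
      have : (s, site s j) \in (s, site s j') |` U' by rewrite -UU' fset1U1.
      rewrite !inE => /orP[/eqP[/site_inj //]|].
      by move=> /(below_projection U' s X UX' Xs) /=; rewrite ltnn.
    by rewrite -jj' in UU' jU' *; rewrite -(fsetU1K jU) UU' fsetU1K.
  move=> S; rewrite mem_filter; apply/andP/allpairsPdep.
    move=> [/andP[SX /hasP[k ks /andP[kS kX]]]]; rewrite fpowersetE => SL.
    exists k, (S `\ (s, site s k)); split; rewrite // ?/add ?fsetD1K //.
    rewrite mem_filter kX fpowersetE.
    exact: fsubset_trans (fsubD1set _ _) SL.
  move=> [k [U [ks + ->]]]; rewrite mem_filter fpowersetE => /andP[/eqP UX UL].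
  have [kU kX] := projection_site U s X k Xs UX.
  rewrite fpowersetE /add kX eqxx fsubUset UL fsub1set.
  rewrite site_lattice; last 2 first.
  - exact: sn.
  - by rewrite mem_index_iota in ks.
  split=> //; apply/hasP; exists k => //.
  by rewrite /splits fset1U1 fsetU1K // UX eqxx.
rewrite big_allpairs_dep; rewrite [LHS]big_seq [RHS]big_seq.
apply: eq_bigr => k; rewrite mem_index_iota => /andP[_ ks].
rewrite /site_energy mulr_sumr /lower big_filter.
rewrite [LHS]big_seq_cond [RHS]big_seq_cond.
apply: eq_bigr => S; rewrite fpowersetE => /andP[SL /eqP SX].
rewrite /F /add coefficient_top ?exprMn ?site_lattice //.
exact: below_projection SX Xs.
Qed.

Lemma coefficient_empty (f : {fset nat * int} -> R) :
  coefficient L f fset0 = average L f.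
Proof. by apply: eq_average => A; rewrite /character big_seq_fset0 mul1r. Qed.

Lemma eq_coefficient (f g : {fset nat * int} -> R) S :
  f =1 g -> coefficient L f S = coefficient L g S.
Proof. by move=> fg; apply: eq_average => A; rewrite fg. Qed.

(** Only [fset0] has an empty projection, and the coefficient of an indicator
there is the probability that the walk visits the site. *)
Lemma level_energy_empty s : (s < n)%N ->
  level_energy s fset0 = walk_prob R (2 * s) 0.
Proof.
move=> sn; rewrite -(@sum_step_kernel_sq R s 0 s.+1) //.
apply: eq_big_nat => k /andP[_ ks].
rewrite /site_energy big_mkcond (bigD1_seq fset0) /=; last 2 first.
- by rewrite fpowersetE fsub0set.
- exact: fset_uniq.
rewrite /first_projection imfset0 eqxx big1 ?addr0; last first.
  move=> S; case: (fset_0Vmem S) => [->|[p pS _]]; first by rewrite eqxx.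
  case: eqP => // S0.
  have : p.1 \in first_projection S by apply: in_imfset.
  by rewrite /first_projection S0 inE.
have -> : site s k = (2 * k)%:Z - s%:Z - (2 * 0)%:Z by rewrite /site; lia.
congr (_ ^+ 2); rewrite (eq_coefficient _ _ _ (visits_martingale _ _)).
rewrite coefficient_transform coefficient_empty average_cst.
rewrite big_seq big1 ?addr0 // => t; rewrite mem_index_iota => /andP[_ ts].
rewrite big_seq big1 // => j; rewrite mem_index_iota => /andP[_ jt].
rewrite coefficient_step_notin ?mulr0 ?in_fset0 //.
by apply: site_lattice => //; exact: ltn_trans sn.
Qed.

(** The squared jump summed over the sites of level [s] is the same for every
starting site of level [r], which is why the energy of level [r] factors
out. *)
Lemma level_energyU1 r s X : (r < s < n)%N ->
  (forall z, z \in X -> (z < r)%N) ->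
  level_energy s (r |` X)
  = level_energy r X * (walk_prob R (2 * (s - r.+1)) 0
                        - walk_prob R (2 * (s - r)) 0).
Proof.
move=> /andP[rs sn] Xr.
transitivity (\sum_(0 <= k < s.+1) \sum_(0 <= j < r.+1)
   kernel_jump R (s - r.+1) (site s k - site r j) ^+ 2 * site_energy r X j).
  apply: eq_bigr => k _; rewrite /site_energy.
  under eq_bigr => S _
    do rewrite (eq_coefficient _ _ _ (visits_martingale _ _)).
  by rewrite energy_transform // ltnW.
rewrite exchange_big /level_energy mulr_suml.
apply: eq_big_nat => j /andP[_ jr].
rewrite -mulr_suml mulrC; congr (_ * _).
have -> : (s - r = (s - r.+1).+1)%N by lia.
rewrite -(@sum_kernel_jump_sq R (s - r.+1) j s.+1); last by lia.
apply: eq_bigr => k _; congr (kernel_jump _ _ _ ^+ 2).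
by rewrite /site; lia.
Qed.

Lemma energy_endpoint s X : (s < n)%N -> (forall z, z \in X -> (z < s)%N) ->
  \sum_(S <- fpowerset L | first_projection S == s |` X)
     coefficient L (fun A => (position A n)%:~R) S ^+ 2
  = level_energy s X.
Proof.
move=> sn Xs.
under eq_bigr => S _ do rewrite (eq_coefficient _ _ _ (endpoint_transform n)).
rewrite energy_transform // /level_energy.
by apply: eq_bigr => k _; rewrite expr1n mul1r.
Qed.

End Coefficients.
End Walk.

(** * Transfer to arbitrary independent signs *)

Section Law.
Context {R : realType} {d : measure_display} {T : measurableType d}.
Context (P : probability T R) (n : nat) (tau : nat * int -> {RV P >-> int}).
Context (signs : random_signs n tau).
Local Notation L := (lattice n).

Definition minus_signs (w : T) : {fset nat * int} :=
  [fset p in L | tau p w == -1].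

Lemma in_minus_signs w p : (p \in minus_signs w) = (p \in L) && (tau p w == -1).
Proof. by rewrite /minus_signs; move: L => D; rewrite !inE. Qed.

Lemma sign_at_minus w p : p \in L -> sign_at (minus_signs w) p = tau p w.
Proof.
case: signs => sg _ _ _ pL; rewrite /sign_at in_minus_signs pL /=.
by case: (sg p w pL) => ->.
Qed.

Lemma walk_position t w : (t <= n)%N ->
  walk tau t w = position (minus_signs w) t.
Proof.
elim: t => [//|t IH tn].
rewrite [LHS]/= [RHS]/= (IH (ltnW tn)) sign_at_minus; first by [].
have [k kt ->] := position_site (minus_signs w) t.
exact: site_lattice.
Qed.

Lemma minus_signsE A : A `<=` L ->
  [set w | minus_signs w = A]
  = [set w | forall i, i \in L -> [set sign_at A i] (tau i w)].
Proof.
move=> AL; case: signs => sg _ _ _; apply/seteqP; split=> w /=.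
  by move=> <- p pL; rewrite sign_at_minus.
move=> wA; apply/fsetP => p; rewrite in_minus_signs.
case: (boolP (p \in L)) => pL /=; last first.
  by apply/esym/negbTE; apply: contra pL => /(fsubsetP AL).
by rewrite (wA p pL) /sign_at; case: ifP.
Qed.

Lemma minus_signs_sub w : minus_signs w `<=` L.
Proof. by apply/fsubsetP => p; rewrite in_minus_signs => /andP[]. Qed.

Lemma measurable_minus_signs A : measurable [set w | minus_signs w = A].
Proof.
have [AL|AL] := boolP (A `<=` L); last first.
  rewrite (_ : [set _ | _] = set0) //; apply/seteqP; split=> // w /= wA.
  by move: AL; rewrite -wA minus_signs_sub.
rewrite minus_signsE //.
have -> : [set w | forall i, i \in L -> [set sign_at A i] (tau i w)]
        = \bigcap_(i in [set` L]) (tau i @^-1` [set sign_at A i]) by [].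
apply: fin_bigcap_measurable => // i _.
exact: measurable_funPTI.
Qed.

Lemma minus_signs_law A : A `<=` L ->
  P [set w | minus_signs w = A] = (2 ^- #|` L|)%:E.
Proof.
move=> AL; case: signs => _ neg pos indep.
have := indep L (fun p => [set sign_at A p]) (fsubset_refl L) (fun _ _ => I).
rewrite -minus_signsE // => ->; rewrite big_seq.
under eq_bigr => p pL.
  have -> : P (tau p @^-1` [set sign_at A p]) = (2^-1)%:E.
    by rewrite /sign_at; case: ifP => _; [exact: neg|exact: pos].
  over.
rewrite -big_seq prodEFin big_const_seq count_predT iter_mulr_1.
by rewrite exprVn.
Qed.

Lemma expectation_minus_signs (h : {fset nat * int} -> R) :
  ('E_P[fun w => h (minus_signs w)] = (average L h)%:E)%E.
Proof.
pose atom A := [set w | minus_signs w = A].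
have intf A : P.-integrable setT (fun w => (\1_(atom A) w)%:E).
  by apply: integrable_indic => //; exact: measurable_minus_signs.
pose f A w := ((h A)%:E * (\1_(atom A) w)%:E)%E.
transitivity (\int[P]_w \sum_(A <- fpowerset L) f A w)%E.
  rewrite unlock; apply: eq_integral => w _.
  rewrite (bigD1_seq (minus_signs w)) ?fset_uniq //=; last first.
    by rewrite fpowersetE minus_signs_sub.
  rewrite big1 ?adde0 => [|A Aw]; last first.
    by rewrite /f indicE memNset ?mule0 // => wA; rewrite -wA eqxx in Aw.
  by rewrite /f indicE mem_set // mule1.
rewrite integral_sum //; last by move=> A; exact: integrableZl.
transitivity (\sum_(A <- fpowerset L) (h A * 2 ^- #|` L|)%:E)%E.
  rewrite !big_seq; apply: eq_bigr => A; rewrite fpowersetE => AL.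
  rewrite integralZl // integral_indic ?setIT //; last first.
    exact: measurable_minus_signs.
  by rewrite EFinM; congr (_ * _)%E; exact: minus_signs_law.
by rewrite sumEFin -mulr_suml mulrC.
Qed.

Lemma fourier_walsh_endpoint S : S `<=` L ->
  fourier_walsh tau (endpoint tau n) S
  = (Num.sqrt n%:R)^-1 * coefficient L (fun A => (position A n)%:~R) S.
Proof.
move=> SL; rewrite /coefficient -averageZ.
rewrite /fourier_walsh [X in fine X](_ : _ = (average L (fun A =>
   (Num.sqrt n%:R)^-1 * (character S A * (position A n)%:~R)))%:E) //.
rewrite -expectation_minus_signs; congr ('E_P[_])%E; apply/funext => w.
rewrite /endpoint walk_position // mulrCA; congr (_ * (_ * _)).
rewrite /character /walsh !big_seq; congr (_%:~R); apply: eq_bigr => p pS.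
by rewrite sign_at_minus //; exact: (fsubsetP SL).
Qed.

Lemma spectral_measure_projection s (X : {fset nat}) : (s < n)%N ->
  (forall z, z \in X -> (z < s)%N) ->
  spectral_measure tau n (endpoint tau n)
    [set S | first_projection S = s |` X]
  = n%:R^-1 * level_energy n s X.
Proof.
move=> sn Xs; rewrite -energy_endpoint // mulr_sumr /spectral_measure.
rewrite [LHS]big_seq_cond [RHS]big_seq_cond.
apply: eq_big => [S|S /andP[+ _]].
  by congr andb; apply/idP/eqP; rewrite inE.
rewrite fpowersetE => SL; rewrite fourier_walsh_endpoint //.
by rewrite real_normK ?num_real // exprMn exprVn sqr_sqrtr ?ler0n.
Qed.

End Law.

(** * Product over the prescribed times *)

Lemma initial_times (x : nat -> nat) m :
  [fset x k | k in iota 1 m.+1] = x m.+1 |` [fset x k | k in iota 1 m].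
Proof.
apply/fsetP => z; rewrite !inE; apply/imfsetP/orP => /=.
  move=> [k km ->]; case: (eqVneq k m.+1) => [->|k_m]; first by left.
  right; apply/imfsetP; exists k => //=; move: km; rewrite inE !mem_iota; lia.
move=> [/eqP ->|/imfsetP[k /= km ->]].
  by exists m.+1; rewrite /= ?inE ?mem_iota; lia.
by exists k => //; move: km; rewrite /= inE !mem_iota; lia.
Qed.

Lemma initial_times_lt (x : nat -> nat) m :
  (forall k, (1 <= k < m.+1)%N -> (x k < x k.+1)%N) ->
  forall z, z \in [fset x k | k in iota 1 m] -> (z < x m.+1)%N.
Proof.
elim: m => [|m IH] hx z; first by move=> /imfsetP[].
rewrite initial_times !inE => /orP[/eqP ->|zm]; first by apply: hx; lia.
apply: (@ltn_trans (x m.+1)); last by apply: hx; lia.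
by apply: IH => // k km; apply: hx; lia.
Qed.

Lemma level_energy_product (R : realType) n (x : nat -> nat) m :
  (forall k, (1 <= k < m.+1)%N -> (x k < x k.+1)%N) -> (x m.+1 < n)%N ->
  level_energy n (x m.+1) [fset x k | k in iota 1 m]
  = walk_prob R (2 * x 1%N) 0 *
    \prod_(1 <= k < m.+1)
      (walk_prob R (2 * x k.+1 - 2 * x k - 2) 0
       - walk_prob R (2 * x k.+1 - 2 * x k) 0).
Proof.
elim: m => [|m IH] hx xn.
  rewrite big_geq // mulr1 -(level_energy_empty n) //.
  congr (level_energy _ _ _).
  by apply/fsetP => z; rewrite in_fset0; apply/imfsetP => -[].
have lt_x : (x m.+1 < x m.+2)%N by apply: hx; lia.
have hx' k : (1 <= k < m.+1)%N -> (x k < x k.+1)%N by move=> km; apply: hx; lia.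
rewrite initial_times level_energyU1 ?lt_x //; last exact: initial_times_lt.
rewrite IH //; last exact: ltn_trans xn.
rewrite [in RHS]big_nat_recr //= mulrA.
by congr (_ * (walk_prob _ _ _ - walk_prob _ _ _)); lia.
Qed.

Theorem proposition1p3 (R : realType)
    (d : measure_display) (T : measurableType d) (P : probability T R)
    (n : nat) (tau : nat * int -> {RV P >-> int})
    (d' : measure_display) (T' : measurableType d') (Q : probability T' R)
    (Srandom : {RV Q >-> {fset nat * int}})
    (m : nat) (x : nat -> nat) :
  (1 <= n)%N ->
  random_signs n tau ->
  (forall A : set {fset nat * int},
     distribution Q Srandom A
       = (spectral_measure tau n (endpoint tau n) A)%:E) ->
  (1 <= m <= n)%N ->
  (forall k, (1 <= k < m)%N -> (x k < x k.+1)%N) ->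
  (x m < n)%N ->
  Q [set w | first_projection (Srandom w) = [fset x k | k in iota 1 m]]
    = (n%:R^-1 * walk_prob R (2 * x 1%N) 0 *
       \prod_(1 <= k < m)
         (walk_prob R (2 * x k.+1 - 2 * x k - 2) 0
          - walk_prob R (2 * x k.+1 - 2 * x k) 0))%:E.
Proof.
move=> _ signs law; case: m => [//|m] _ hx xn.
have := law [set S | first_projection S = [fset x k | k in iota 1 m.+1]].
rewrite /distribution /pushforward /= => ->; congr (_%:E).
rewrite initial_times spectral_measure_projection //; last first.
  exact: initial_times_lt.
by rewrite level_energy_product // mulrA.
Qed.
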